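(* Consider either of the two cases (Case 1 or Case 2 of the context) with the corresponding $\alpha_0$, $C$. Fix an initial point $w(0)\in\mathbb{R}^{nd}$ and for $\alpha>0$ let $w_\alpha(t)=(w_1(t)^\top,\dots,w_n(t)^\top)^\top\in\mathbb{R}^{nd}$ be the sequence with $w_\alpha(0)=w(0)$ and $$w_i(t+1)=\sum_{j=1}^nW_{ij}\Big(w_j(t)-\alpha\nabla f_j\Big(\frac{w_j(t)}{y_j(t)}\Big)\Big),\qquad 1\le i\le n,\ t\ge0.$$ Then for every $\alpha\in(0,\alpha_0]$ the sequence $w_\alpha(t)$ converges to the unique fixed point $w^\alpha$ of $T_\alpha$, at a linear rate, with $$\|w_\alpha(t+1)-w^\alpha\|_{\pi\otimes1_d}\le V_\alpha(1-C\alpha)^{t+1}\|w(0)-w^\alpha\|_{\pi\otimes1_d}+\mathcal{R}(t)\qquad\text{for all }t\ge0,$$ where $$\mathcal{R}(t)=\begin{cases}tV_\alpha\,\alpha bR\rho^t+\alpha bR\rho^t&\text{if }1-C\alpha=\rho,\\[1mm]\dfrac{\alpha bRV_\alpha(1-C\alpha)}{1-C\alpha-\rho}\big[(1-C\alpha)^t-\rho^t\big]+\alpha bR\rho^t&\text{if }1-C\alpha\ne\rho,\end{cases}$$ and $V_\alpha=\prod_{j=0}^\infty\big(1+\frac{\alpha b\rho^j}{1-C\alpha}\big)<\infty$.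
   Context: Network: $G=(V,E)$ is a strongly connected directed graph on $V=\{1,\dots,n\}$. $W=(W_{ij})$ is a real nonnegative $n\times n$ matrix with $W_{ij}>0$ if $(i,j)\in E$ or $i=j$, and $W_{ij}=0$ otherwise; $W$ is column stochastic, $\sum_{k=1}^n W_{kj}=1$ for all $j$. $\pi=(\pi_1,\dots,\pi_n)^\top$ is the right eigenvector of $W$ with $W\pi=\pi$ and $\sum_j\pi_j=1$ (all $\pi_j>0$). $W^\infty=\pi1_n^\top$. With $\|v\|_\pi=(\sum_j\frac1{\pi_j}|v_j|^2)^{1/2}$ on $\mathbb{R}^n$ and $|||\cdot|||_\pi$ the induced matrix norm, $\rho=|||W-W^\infty|||_\pi$; it is a standing known fact that $\rho\in(0,1)$. The sequence $y(t)\in\mathbb{R}^n$ is given by $y_j(0)=1$, $y_i(t+1)=\sum_jW_{ij}y_j(t)$. $a>0$ is a constant such that $\big|\frac1{y_j(t)}-\frac1{n\pi_j}\big|\le a\rho^t$ for all $1\le j\le n$, $t\ge0$ (such a constant is known to exist). A function is $L$-smooth if it is differentiable with $L$-Lipschitz gradient. For $w=(w_1^\top,\dots,w_n^\top)^\top\in\mathbb{R}^{nd}$ with $w_j\in\mathbb{R}^d$: $\|w\|_{\pi\otimes1_d}=\big(\sum_{j}\frac1{\pi_j}\|w_j\|^2\big)^{1/2}$; $\nabla F(w)=(\nabla f_1(w_1)^\top,\dots,\nabla f_n(w_n)^\top)^\top$; $J(w)\in\mathbb{R}^{nd}$ has $k$-th block $\sum_{j=1}^nW_{kj}w_j$; $T_\alpha(w)\in\mathbb{R}^{nd}$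 has $k$-th block $\sum_{j=1}^nW_{kj}\big(w_j-\alpha\nabla f_j(\frac{w_j}{n\pi_j})\big)$. Case 1: for each $1\le k\le n$, $f_k:\mathbb{R}^d\to\mathbb{R}$ is $\mu_k$-strongly convex ($\mu_k>0$) and $L_k$-smooth; $\alpha_0=\min_k\frac{2n\pi_k}{L_k+\mu_k}$ and $C=\min_k\frac{\mu_kL_k}{n(\mu_k+L_k)\pi_k}$. Case 2: $f_k(x)=\frac12x^\top A_kx+B_kx$ with $A_k\in\mathbb{R}^{d\times d}$ symmetric positive semidefinite and $B_k\in\mathbb{R}^{1\times d}$, and $f=\frac1n\sum_kf_k$ is $\mu$-strongly convex for some $\mu>0$; $L_k$ is the largest eigenvalue of $A_k$, $\alpha_0=\min_k\frac{2n\pi_k}{L_k+\epsilon}$ for a fixed arbitrary $\epsilon>0$, and $C=\frac{1-\eta_\epsilon}{\alpha_0}$, where $\eta_\epsilon\in(0,1)$ is a contraction constant of $T_{\alpha_0}$, i.e. $\|T_{\alpha_0}(x)-T_{\alpha_0}(y)\|_{\pi\otimes1_d}\le\eta_\epsilon\|x-y\|_{\pi\otimes1_d}$ for all $x,y$ (such a constant exists). In both cases $T_\alpha$ has a unique fixed point $w^\alpha$ for $\alpha\in(0,\alpha_0]$; $L=\max_kL_k$, $b=aL$, and $R=\frac1C\|J(\nabla F(0))\|_{\pi\otimes1_d}$. *)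

(* Defs.v *)
From HB Require Import structures.
From mathcomp Require Export all_boot all_order all_algebra.
From mathcomp Require Export all_classical all_reals all_analysis.

Set Implicit Arguments.
Unset Strict Implicit.
Unset Printing Implicit Defensive.

Export Order.TTheory GRing.Theory Num.Theory numFieldNormedType.Exports.
#[global] Open Scope classical_set_scope.
#[global] Open Scope ring_scope.

(* w = (w_1, ..., w_n) in R^{nd}, given by its n blocks w_j in R^d *)
Notation blocks R n d := ('I_n -> 'cV[R]_d).

(* MathComp-Analysis' `|x| on matrices is the max norm. *)
Definition enorm (R : realType) (d : nat) (x : 'cV[R]_d) : R :=
  Num.sqrt (\sum_(i < d) x i ord0 ^+ 2).

Definition gradient (R : realType) (d : nat) (f : 'cV[R]_d -> R)
    (x : 'cV[R]_d) : 'cV[R]_d :=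
  \col_(i < d) 'D_(delta_mx i ord0) f x.

Definition smooth (R : realType) (d : nat) (L : R) (f : 'cV[R]_d -> R) : Prop :=
  (forall x, differentiable f x) /\
  (forall x y, enorm (gradient f x - gradient f y) <= L * enorm (x - y)).

Definition strongly_convex (R : realType) (d : nat) (mu : R)
    (f : 'cV[R]_d -> R) : Prop :=
  forall (x y : 'cV[R]_d) (s : R), 0 <= s <= 1 ->
    f (s *: x + (1 - s) *: y) <=
      s * f x + (1 - s) * f y - mu / 2 * s * (1 - s) * enorm (x - y) ^+ 2.

Definition psd (R : realType) (d : nat) (A : 'M[R]_d) : Prop :=
  forall x : 'cV[R]_d, 0 <= (x^T *m A *m x) ord0 ord0.

Definition largest_eigenvalue (R : realType) (d : nat) (A : 'M[R]_d) (l : R)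
  : Prop := eigenvalue A l /\ (forall l', eigenvalue A l' -> l' <= l).

(* For n > 0 the range is finite and nonempty, so that these are attained. *)
Definition min_of (R : realType) (n : nat) (F : 'I_n -> R) : R := inf (range F).
Definition max_of (R : realType) (n : nat) (F : 'I_n -> R) : R := sup (range F).

Definition strongly_connected (n : nat) (E : rel 'I_n) : Prop :=
  forall i j, connect E i j.

Definition weight_matrix (R : realType) (n : nat) (E : rel 'I_n) (W : 'M[R]_n)
  : Prop :=
  [/\ forall i j, E i j || (i == j) -> 0 < W i j,
      forall i j, ~~ (E i j || (i == j)) -> W i j = 0 &
      forall j, \sum_(k < n) W k j = 1].

Definition perron_vector (R : realType) (n : nat) (W : 'M[R]_n) (p : 'cV[R]_n)
  : Prop :=
  [/\ W *m p = p, \sum_(j < n) p j ord0 = 1 & forall j, 0 < p j ord0].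

Definition pnorm (R : realType) (n : nat) (p v : 'cV[R]_n) : R :=
  Num.sqrt (\sum_(j < n) (p j ord0)^-1 * `|v j ord0| ^+ 2).

Definition induced_pnorm (R : realType) (n : nat) (p : 'cV[R]_n) (M : 'M[R]_n)
  : R :=
  sup [set pnorm p (M *m v) / pnorm p v | v in [set v : 'cV[R]_n | v != 0]].

Definition Winfty (R : realType) (n : nat) (p : 'cV[R]_n) : 'M[R]_n :=
  p *m (const_mx 1 : 'rV[R]_n).

Definition rho_of (R : realType) (n : nat) (W : 'M[R]_n) (p : 'cV[R]_n) : R :=
  induced_pnorm p (W - Winfty p).

Fixpoint push_sum (R : realType) (n : nat) (W : 'M[R]_n) (t : nat) : 'cV[R]_n :=
  if t is t'.+1 then W *m push_sum W t' else const_mx 1.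

Definition bnorm (R : realType) (n d : nat) (p : 'cV[R]_n) (w : blocks R n d)
  : R :=
  Num.sqrt (\sum_(j < n) (p j ord0)^-1 * enorm (w j) ^+ 2).

Definition gradF (R : realType) (n d : nat) (f : 'I_n -> 'cV[R]_d -> R)
    (w : blocks R n d) : blocks R n d :=
  fun k => gradient (f k) (w k).

Definition Jmap (R : realType) (n d : nat) (W : 'M[R]_n) (w : blocks R n d)
  : blocks R n d :=
  fun k => \sum_(j < n) W k j *: w j.

Definition Tmap (R : realType) (n d : nat) (W : 'M[R]_n) (p : 'cV[R]_n)
    (f : 'I_n -> 'cV[R]_d -> R) (alpha : R) (w : blocks R n d) : blocks R n d :=
  fun k => \sum_(j < n) W k j *:
    (w j - alpha *: gradient (f j) ((n%:R * p j ord0)^-1 *: w j)).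

Fixpoint gradient_push (R : realType) (n d : nat) (W : 'M[R]_n)
    (f : 'I_n -> 'cV[R]_d -> R) (alpha : R) (w0 : blocks R n d) (t : nat)
  : blocks R n d :=
  if t is t'.+1 then
    let w := gradient_push W f alpha w0 t' in
    fun i => \sum_(j < n) W i j *:
      (w j - alpha *:
         gradient (f j) ((push_sum W t' j ord0)^-1 *: w j))
  else w0.

Definition case1 (R : realType) (n d : nat) (p : 'cV[R]_n)
    (f : 'I_n -> 'cV[R]_d -> R) (L : 'I_n -> R) (alpha0 C : R) : Prop :=
  exists mu : 'I_n -> R,
  [/\ forall k, [/\ 0 < mu k, strongly_convex (mu k) (f k) & smooth (L k) (f k)],
      alpha0 = min_of (fun k => 2 * n%:R * p k ord0 / (L k + mu k)) &
      C = min_of (fun k => mu k * L k / (n%:R * (mu k + L k) * p k ord0))].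

Definition case2 (R : realType) (n d : nat) (W : 'M[R]_n) (p : 'cV[R]_n)
    (f : 'I_n -> 'cV[R]_d -> R) (L : 'I_n -> R) (alpha0 C : R) : Prop :=
  exists (A : 'I_n -> 'M[R]_d) (B : 'I_n -> 'rV[R]_d) (mu eps eta : R),
  [/\ (forall k, [/\ (A k)^T = A k, psd (A k) & largest_eigenvalue (A k) (L k)]),
      (forall k x, f k x =
         1 / 2 * (x^T *m A k *m x) ord0 ord0 + (B k *m x) ord0 ord0),
      (0 < mu /\ strongly_convex mu (fun x => 1 / n%:R * \sum_(k < n) f k x)),
      (0 < eps /\ alpha0 = min_of (fun k => 2 * n%:R * p k ord0 / (L k + eps))) &
      [/\ 0 < eta < 1,
          (forall x y : blocks R n d,
             bnorm p (Tmap W p f alpha0 x - Tmap W p f alpha0 y)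
               <= eta * bnorm p (x - y)) &
          C = (1 - eta) / alpha0]].

Definition V_partial (R : realType) (alpha b rho C : R) (N : nat) : R :=
  \prod_(0 <= j < N) (1 + alpha * b * rho ^+ j / (1 - C * alpha)).

Definition V_of (R : realType) (alpha b rho C : R) : R :=
  limn (V_partial alpha b rho C).

Definition remainder (R : realType) (alpha b rho C Rad : R) (t : nat) : R :=
  let V := V_of alpha b rho C in
  if 1 - C * alpha == rho then
    t%:R * V * alpha * b * Rad * rho ^+ t + alpha * b * Rad * rho ^+ t
  else
    alpha * b * Rad * V * (1 - C * alpha) / (1 - C * alpha - rho)
      * ((1 - C * alpha) ^+ t - rho ^+ t)
    + alpha * b * Rad * rho ^+ t.

(* Main.v *)
From HB Require Import structures.
Require Import Defs.
From mathcomp Require Import ring lra.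

(** The iteration is a perturbation of the fixed-point iteration of T_alpha
in the norm [bnorm p].  Write q = 1 - C alpha.

Averaging by the column stochastic matrix W is nonexpansive in [bnorm p]
([Jmap_nonexpansive]): by Jensen, |sum_j W_kj x_j|^2 / pi_k is at most
sum_j W_kj |x_j|^2 / pi_j because W pi = pi, and one sums over k.  Hence T_alpha
is a q-contraction as soon as w |-> w - alpha grad is one.  In the strongly
convex and smooth case this holds block by block
([gradient_step_contraction]), by the coercivity inequality
[strongly_convex_cocoercive]
mu L |x - y|^2 + |grad f x - grad f y|^2 <= (L + mu) <grad f x - grad f y, x - y>.
In the quadratic case T_alpha is a convex combination of the averaging map and
of the eta-contraction T_alpha0; the Lipschitz constant of A x is the largest
eigenvalue of A, because the maximum of the Rayleigh quotient is an eigenvalue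
([Rayleigh_max_eigenvalue]).

Replacing n pi_j by y_j(t) in the gradients moves one step by at most
alpha b rho^t |w(t)| ([push_sum_error]).  Since |w^alpha| <= R
([fixpoint_bound]), the error e_t = |w(t) - w^alpha| satisfies
e_(t+1) <= (q + alpha b rho^t) e_t + alpha b R rho^t.
Unrolling, every product of factors q + alpha b rho^j = q (1 + alpha b rho^j / q)
is at most V times a power of q, and the inhomogeneous part is the convolution
sum_(s < t) q^(t-s) rho^s, evaluated in closed form
([perturbed_recursion_lim], [geometric_convolution]).  The fixed point exists
and is unique by the contraction principle. *)

Set Implicit Arguments.
Unset Strict Implicit.
Unset Printing Implicit Defensive.

(** * Positive semidefinite bilinear forms *)

Section PsdForm.
Variables (R : realType) (V : lmodType R) (B : V -> V -> R).

(** A symmetric bilinear form with [0 <= B x x]; it may be degenerate. *)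
Definition psd_form : Prop :=
  [/\ forall x y, B x y = B y x,
      forall c x y z, B (c *: x + y) z = c * B x z + B y z &
      forall x, 0 <= B x x].

Hypothesis psdB : psd_form.

Let Bsym : forall x y, B x y = B y x. Proof. by case: psdB. Qed.
Let Blin : forall c x y z, B (c *: x + y) z = c * B x z + B y z.
Proof. by case: psdB. Qed.
Let Bpos : forall x, 0 <= B x x. Proof. by case: psdB. Qed.

Lemma psd_form_expand c x y :
  B (c *: x + y) (c *: x + y) = c ^+ 2 * B x x + 2 * c * B x y + B y y.
Proof.
rewrite Blin (Bsym x) (Bsym y) !Blin (Bsym y x); ring.
Qed.

Lemma psd_formZ c x : B (c *: x) (c *: x) = c ^+ 2 * B x x.
Proof.
have h z : B 0 z = 0 by have := Blin 1 0 0 z; rewrite scaler0 addr0; lra.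
by have := psd_form_expand c x 0; rewrite addr0 (Bsym x) !h mulr0 !addr0.
Qed.

(** Both [B x x * det] and [B y y * det] are nonnegative, where [det] is the
Gram determinant; if [B x x = B y y = 0], positivity at [y - B x y *: x]
forces [B x y = 0]. *)
Lemma psd_form_CauchySchwarz x y : B x y ^+ 2 <= B x x * B y y.
Proof.
have h1 : 0 <= B x x * (B x x * B y y - B x y ^+ 2).
  have := Bpos ((- B x y) *: x + B x x *: y).
  rewrite psd_form_expand psd_formZ (Bsym x (_ *: y)) -[_ *: y]addr0 Blin.
  have -> : B 0 x = 0 by have := Blin 1 0 0 x; rewrite scaler0 addr0; lra.
  by rewrite (Bsym y x); nra.
have h2 : 0 <= B y y * (B x x * B y y - B x y ^+ 2).
  have := Bpos ((- B x y) *: y + B y y *: x).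
  rewrite psd_form_expand psd_formZ (Bsym y (_ *: x)) -[_ *: x]addr0 Blin.
  have -> : B 0 y = 0 by have := Blin 1 0 0 y; rewrite scaler0 addr0; lra.
  by nra.
have hx := Bpos x; have hy := Bpos y.
have [h|h] := ltP 0 (B x x + B y y).
  rewrite -subr_ge0 -(pmulr_rge0 _ h); nra.
have x0 : B x x = 0 by lra.
have y0 : B y y = 0 by lra.
have := Bpos ((- B x y) *: x + y); rewrite psd_form_expand x0 y0; nra.
Qed.

Lemma psd_form_le_sqrt x y : B x y <= Num.sqrt (B x x) * Num.sqrt (B y y).
Proof.
rewrite -sqrtrM ?Bpos//; apply: (le_trans (ler_norm _)).
by rewrite -sqrtr_sqr ler_wsqrtr// psd_form_CauchySchwarz.
Qed.

Lemma psd_form_Minkowski x y :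
  Num.sqrt (B (x + y) (x + y)) <= Num.sqrt (B x x) + Num.sqrt (B y y).
Proof.
rewrite -[leRHS]ger0_norm ?addr_ge0 ?sqrtr_ge0// -sqrtr_sqr ler_wsqrtr//.
have := psd_form_expand 1 x y; rewrite scale1r => ->.
rewrite sqrrD !sqr_sqrtr ?Bpos//; have := psd_form_le_sqrt x y; lra.
Qed.

Lemma sqrt_psd_formZ c x :
  Num.sqrt (B (c *: x) (c *: x)) = `|c| * Num.sqrt (B x x).
Proof. by rewrite psd_formZ sqrtrM ?sqr_ge0// sqrtr_sqr. Qed.

End PsdForm.

(** * The Euclidean norm and the weighted block norm *)

Section Norms.
Variables (R : realType) (d : nat).
Implicit Types x y : 'cV[R]_d.

(** The Euclidean inner product, whose norm is [enorm]. *)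
Definition dot x y : R := \sum_(i < d) x i ord0 * y i ord0.

Lemma dot_psd : psd_form dot.
Proof.
split=> [x y|c x y z|x].
- by apply: eq_bigr => i _; rewrite mulrC.
- rewrite /dot mulr_sumr -big_split; apply: eq_bigr => i _ /=.
  by rewrite !mxE; ring.
- by apply: sumr_ge0 => i _; rewrite -expr2 sqr_ge0.
Qed.

Lemma dotC x y : dot x y = dot y x. Proof. by case: dot_psd. Qed.
Lemma dotDl x y z : dot (x + y) z = dot x z + dot y z.
Proof. by case: dot_psd => _ h _; have := h 1 x y z; rewrite scale1r mul1r. Qed.
Lemma dot0l x : dot 0 x = 0.
Proof. by rewrite /dot big1// => i _; rewrite mxE mul0r. Qed.
Lemma dotZl c x z : dot (c *: x) z = c * dot x z.
Proof.
by case: dot_psd => _ h _; have := h c x 0 z; rewrite dot0l !addr0.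
Qed.
Lemma dotNl x z : dot (- x) z = - dot x z.
Proof. by rewrite -scaleN1r dotZl mulN1r. Qed.
Lemma dotBl x y z : dot (x - y) z = dot x z - dot y z.
Proof. by rewrite dotDl dotNl. Qed.
Lemma dotBr x y z : dot z (x - y) = dot z x - dot z y.
Proof. by rewrite ![dot z _]dotC dotBl. Qed.
Lemma dotDr x y z : dot z (x + y) = dot z x + dot z y.
Proof. by rewrite ![dot z _]dotC dotDl. Qed.
Lemma dotZr c x z : dot z (c *: x) = c * dot z x.
Proof. by rewrite ![dot z _]dotC dotZl. Qed.
Lemma dot_ge0 x : 0 <= dot x x. Proof. by case: dot_psd. Qed.

Lemma enormE x : enorm x = Num.sqrt (dot x x).
Proof. by []. Qed.
Lemma enorm_sqr x : enorm x ^+ 2 = dot x x.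
Proof. by rewrite enormE sqr_sqrtr ?dot_ge0. Qed.
Lemma enorm_ge0 x : 0 <= enorm x. Proof. exact: sqrtr_ge0. Qed.
Lemma enormZ c x : enorm (c *: x) = `|c| * enorm x.
Proof. exact: (sqrt_psd_formZ dot_psd). Qed.
Lemma dot_le_enorm x y : dot x y <= enorm x * enorm y.
Proof. exact: (psd_form_le_sqrt dot_psd). Qed.
Lemma enorm_entry x i j : `|x i j| <= enorm x.
Proof.
rewrite (ord1 j) -sqrtr_sqr ler_wsqrtr// (bigD1 i)//= lerDl.
by apply: sumr_ge0 => k _; rewrite sqr_ge0.
Qed.

End Norms.

Section BlockNorm.
Variables (R : realType) (n d : nat) (p : 'cV[R]_n).
Hypothesis p_gt0 : forall j, 0 < p j ord0.
Implicit Types w v : blocks R n d.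

Let pinv_ge0 j : 0 <= (p j ord0)^-1.
Proof. by rewrite invr_ge0 ltW. Qed.

(** The inner product whose norm is [bnorm p]. *)
Definition bdot w v : R := \sum_(j < n) (p j ord0)^-1 * dot (w j) (v j).

Lemma bdot_psd : psd_form bdot.
Proof.
split=> [x y|c x y z|x].
- by apply: eq_bigr => i _; rewrite dotC.
- rewrite /bdot mulr_sumr -big_split; apply: eq_bigr => i _ /=.
  by rewrite dotDl dotZl; ring.
- by apply: sumr_ge0 => i _; rewrite mulr_ge0 ?dot_ge0 ?invr_ge0 ?ltW.
Qed.

Lemma bnormE w : bnorm p w = Num.sqrt (bdot w w).
Proof. by congr Num.sqrt; apply: eq_bigr => j _; rewrite enorm_sqr. Qed.

Lemma bnorm_ge0 w : 0 <= bnorm p w. Proof. exact: sqrtr_ge0. Qed.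

Lemma bnormZ c w : bnorm p (c *: w) = `|c| * bnorm p w.
Proof. by rewrite !bnormE (sqrt_psd_formZ bdot_psd). Qed.

Lemma bnormN w : bnorm p (- w) = bnorm p w.
Proof. by rewrite -scaleN1r bnormZ normrN1 mul1r. Qed.

Lemma bnormD w v : bnorm p (w + v) <= bnorm p w + bnorm p v.
Proof. by rewrite !bnormE (psd_form_Minkowski bdot_psd). Qed.

Lemma bnorm_distC w v : bnorm p (w - v) = bnorm p (v - w).
Proof. by rewrite -opprB bnormN. Qed.

Lemma bnorm_block w k : enorm (w k) <= Num.sqrt (p k ord0) * bnorm p w.
Proof.
have pk := p_gt0 k.
rewrite -(sqrtrM _ (ltW pk)) -[leLHS]ger0_norm ?enorm_ge0// -sqrtr_sqr ler_wsqrtr//.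
rewrite (bigD1 k)//= mulrDr mulrA divff ?gt_eqF// mul1r lerDl.
apply: mulr_ge0; first exact: ltW.
by apply: sumr_ge0 => j _; rewrite mulr_ge0 ?sqr_ge0.
Qed.

Lemma ler_bnorm c w v : 0 <= c ->
  (forall j, enorm (w j) <= c * enorm (v j)) -> bnorm p w <= c * bnorm p v.
Proof.
move=> c0 h; rewrite -(ger0_norm c0) -bnormZ ler_wsqrtr//.
apply: ler_sum => j _; rewrite ler_wpM2l ?pinv_ge0//.
by rewrite lerXn2r ?nnegrE ?enorm_ge0// enormZ ger0_norm.
Qed.

Lemma bnorm_eq0 w : bnorm p w <= 0 -> w = 0.
Proof.
move=> w0; apply/funext => k; apply/matrixP => i j; rewrite [RHS]mxE.
apply/eqP; rewrite -normr_le0.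
apply: (le_trans (enorm_entry _ _ _)); apply: (le_trans (bnorm_block _ _)).
by rewrite mulr_ge0_le0 ?sqrtr_ge0.
Qed.

Lemma bnorm_block_norm w k : `|w k| <= Num.sqrt (p k ord0) * bnorm p w.
Proof.
rewrite [leLHS]/Num.norm/= mx_normrE.
apply: bigmax_le => [|[i j] _]; first by rewrite mulr_ge0 ?sqrtr_ge0.
exact: (le_trans (enorm_entry _ _ _) (bnorm_block _ _)).
Qed.

Lemma enorm_le_norm (x : 'cV[R]_d) : enorm x <= Num.sqrt d%:R * `|x|.
Proof.
rewrite -[`|x|]ger0_norm// -sqrtr_sqr -sqrtrM// ler_wsqrtr//.
rewrite -[d in d%:R]card_ord -[leLHS]mul1r mulr_natl -sumr_const mul1r.
apply: ler_sum => i _; rewrite -[leLHS]real_normK ?num_real//.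
rewrite lerXn2r ?nnegrE// [leRHS]/Num.norm/= mx_normrE.
exact: (le_bigmax _ (fun ij => `|x ij.1 ij.2|) (i, ord0)).
Qed.

Lemma bnorm_le_norm (c : R) w : 0 <= c -> (forall k, `|w k| <= c) ->
  bnorm p w <= c * Num.sqrt (\sum_j (p j ord0)^-1 * d%:R).
Proof.
move=> c0 h; rewrite -{1}(ger0_norm c0) -sqrtr_sqr -sqrtrM ?sqr_ge0// ler_wsqrtr//.
rewrite mulr_sumr; apply: ler_sum => j _.
rewrite [leRHS]mulrCA ler_wpM2l ?pinv_ge0//.
rewrite -(sqr_sqrtr (ler0n R d)) -exprMn lerXn2r ?nnegrE ?enorm_ge0//.
  by rewrite mulr_ge0// sqrtr_ge0.
by rewrite (le_trans (enorm_le_norm _))// mulrC ler_wpM2r ?sqrtr_ge0.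
Qed.

End BlockNorm.

(** * A linear recursion with geometrically decaying perturbations *)

Section Sequences.
Variables (R : realType) (c q rho : R).
Hypotheses (c_ge0 : 0 <= c) (q01 : 0 < q < 1) (rho01 : 0 < rho < 1).

Let q_gt0 : 0 < q. Proof. by case/andP: q01. Qed.
Let rho_gt0 : 0 < rho. Proof. by case/andP: rho01. Qed.

(** The factor by which the perturbations of the steps [s], ..., [t - 1] can
inflate a product of contraction factors. *)
Definition infl (s t : nat) : R := \prod_(s <= j < t) (1 + c * rho ^+ j / q).

Let incr j : 0 <= c * rho ^+ j / q.
Proof. by rewrite !mulr_ge0 ?invr_ge0 ?exprn_ge0// ltW. Qed.

Lemma infl_ge0 s t : 0 <= infl s t.
Proof. by apply: prodr_ge0 => j _; rewrite addr_ge0. Qed.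

Lemma infl_ge1 s t : 1 <= infl s t.
Proof.
rewrite /infl; apply: (big_ind (fun x => 1 <= x)) => // [x y x1 y1|j _].
  by rewrite -[leLHS]mulr1 ler_pM.
by rewrite lerDl.
Qed.

Lemma inflSr s t : (s <= t)%N ->
  infl s t.+1 = infl s t * (1 + c * rho ^+ t / q).
Proof. by move=> st; rewrite /infl big_nat_recr. Qed.

Lemma inflnn t : infl t t = 1.
Proof. by rewrite /infl big_geq. Qed.

Lemma infl_nd : nondecreasing_seq (infl 0).
Proof.
apply/nondecreasing_seqP => t; rewrite inflSr// -[leLHS]mulr1 ler_wpM2l ?infl_ge0//.
by rewrite lerDl.
Qed.

Lemma infl_leS s t : infl s t <= infl 0 t.
Proof.
have [ts|st] := leqP t s.
  by rewrite {1}/infl big_geq// infl_ge1.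
rewrite [leRHS]/infl (big_cat_nat (leq0n s) (ltnW st))/=.
by rewrite -[leLHS]mul1r ler_wpM2r ?infl_ge0 ?infl_ge1.
Qed.

(** The partial products are bounded by the exponential of a geometric sum. *)
Lemma infl_cvg : cvgn (infl 0).
Proof.
apply: nondecreasing_is_cvgn; first exact: infl_nd.
exists (expR (c / q / (1 - rho))) => _ [t _ <-].
have h1 : infl 0 t <= expR (\sum_(0 <= j < t) c * rho ^+ j / q).
  rewrite expR_sum; apply: ler_prod => j _.
  by rewrite addr_ge0//= expR_ge1Dx.
apply: (le_trans h1); rewrite ler_expR.
have -> : \sum_(0 <= j < t) c * rho ^+ j / q = c / q * \sum_(j < t) rho ^+ j.
  by rewrite big_mkord mulr_sumr; apply: eq_bigr => j _; rewrite mulrAC.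
rewrite ler_wpM2l ?divr_ge0// ?(ltW q_gt0)//.
have r1 : 0 < 1 - rho by case/andP: rho01; lra.
rewrite -[leRHS]mul1r ler_pdivlMr// mulrC -opprB mulNr -subrX1 opprB.
by rewrite lerBlDr lerDl exprn_ge0// ltW.
Qed.

(** The infinite product: the constant V, for [c = alpha * b] and
[q = 1 - C * alpha]. *)
Definition infl_lim : R := limn (infl 0).

Lemma infl_le_lim s t : infl s t <= infl_lim.
Proof.
by apply: (le_trans (infl_leS s t)); apply: nondecreasing_cvgn_le;
  [exact: infl_nd|exact: infl_cvg].
Qed.

Lemma perturbed_recursion (r : R) (e : nat -> R) : 0 <= r ->
  (forall t, e t.+1 <= (q + c * rho ^+ t) * e t + c * r * rho ^+ t) ->
  forall t, e t <= infl 0 t * q ^+ t * e 0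
      + c * r * \sum_(s < t) infl s.+1 t * q ^+ (t - s.+1) * rho ^+ s.
Proof.
move=> r0 he; elim=> [|t IH].
  by rewrite big_ord0 mulr0 addr0 inflnn expr0 !mul1r.
apply: (le_trans (he t)).
have fE : q + c * rho ^+ t = q * (1 + c * rho ^+ t / q).
  by field; rewrite gt_eqF.
rewrite big_ord_recr/= subnn expr0 mulr1 inflnn mul1r mulrDr addrA.
rewrite lerD2r.
have f0 : 0 <= q + c * rho ^+ t.
  by rewrite addr_ge0 ?mulr_ge0 ?exprn_ge0// ltW.
apply: (le_trans (ler_wpM2l f0 IH)); rewrite le_eqVlt; apply/orP; left; apply/eqP.
rewrite mulrDr inflSr// fE exprS; congr (_ + _); first by ring.
rewrite mulrCA; congr (_ * _); rewrite mulr_sumr; apply: eq_bigr => s _.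
by rewrite inflSr// subSn// exprS; ring.
Qed.

(** The last term of the sum carries an empty product, hence no factor
[infl_lim]. *)
Lemma perturbed_recursion_lim (r : R) (e : nat -> R) : 0 <= r -> 0 <= e 0 ->
  (forall t, e t.+1 <= (q + c * rho ^+ t) * e t + c * r * rho ^+ t) ->
  forall t, e t.+1 <= infl_lim * q ^+ t.+1 * e 0
      + infl_lim * c * r * (\sum_(s < t) q ^+ (t - s) * rho ^+ s)
      + c * r * rho ^+ t.
Proof.
move=> r0 e0 he t; apply: (le_trans (perturbed_recursion r0 he _)).
rewrite big_ord_recr/= subnn expr0 mulr1 inflnn mul1r mulrDr addrA.
rewrite lerD2r lerD//.
  by rewrite -!mulrA ler_wpM2r ?infl_le_lim// mulr_ge0// exprn_ge0// ltW.
rewrite -!mulrA [leRHS]mulrCA ler_wpM2l// [leRHS]mulrCA ler_wpM2l//.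
rewrite mulr_sumr; apply: ler_sum => s _.
rewrite subSS -mulrA ler_wpM2r ?infl_le_lim//.
by rewrite mulr_ge0// exprn_ge0// ltW.
Qed.

Lemma geometric_convolution t : \sum_(s < t) q ^+ (t - s) * rho ^+ s =
  if q == rho then t%:R * rho ^+ t
  else q * (q ^+ t - rho ^+ t) / (q - rho).
Proof.
case: eqVneq => [->|qr].
  rewrite mulr_natl -[in RHS](card_ord t) -sumr_const.
  by apply: eq_bigr => s _; rewrite -exprD subnK ?card_ord// ltnW.
have qr0 : q - rho != 0 by rewrite subr_eq0.
rewrite subrXX [q * _]mulrCA [RHS]mulrAC divff// mul1r mulr_sumr.
apply: eq_bigr => s _; rewrite mulrA -exprS.
by case: t s => [[]//|t] s /=; rewrite subSn// -ltnS.
Qed.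

(** A rate [m] strictly above both [q] and [rho] absorbs the factor [t] that
appears when they coincide. *)
Lemma geometric_convolution_rate : exists K m : R,
  [/\ 0 <= K, 0 < m < 1, q <= m, rho <= m &
      forall t, \sum_(s < t) q ^+ (t - s) * rho ^+ s <= K * m ^+ t].
Proof.
pose m0 := Num.max q rho.
have m0lt : m0 < 1 by rewrite gt_max; case/andP: q01 => _ ->; case/andP: rho01.
have qm0 : q <= m0 by rewrite le_max lexx.
have rm0 : rho <= m0 by rewrite le_max lexx orbT.
have m0gt : 0 < m0 by rewrite (lt_le_trans q_gt0).
pose m := (1 + m0) / 2.
have m0m : m0 < m by rewrite /m; lra.
have m1 : m < 1 by rewrite /m; lra.
have m_gt0 : 0 < m by lra.
pose h := m / m0 - 1.
have h_gt0 : 0 < h by rewrite subr_gt0 ltr_pdivlMr// mul1r.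
(* Bernoulli: the linear factor t is absorbed by the ratio 1 + h = m / m0 *)
have bern t : t%:R * h <= (1 + h) ^+ t.
  elim: t => [|t IH]; first by rewrite mul0r expr0.
  have h1 : 1 <= (1 + h) ^+ t by rewrite exprn_ege1// lerDl ltW.
  by rewrite exprS -natr1; nra.
exists h^-1, m; split.
- by rewrite invr_ge0 ltW.
- by rewrite m_gt0 m1.
- exact: (le_trans qm0 (ltW m0m)).
- exact: (le_trans rm0 (ltW m0m)).
move=> t; apply: (@le_trans _ _ (t%:R * m0 ^+ t)).
  rewrite mulr_natl -[X in _ *+ X](card_ord t) -sumr_const.
  apply: ler_sum => s _.
  have -> : m0 ^+ t = m0 ^+ (t - s) * m0 ^+ s.
    by rewrite -exprD subnK// ltnW.
  by rewrite ler_pM ?exprn_ge0 ?(ltW q_gt0) ?(ltW rho_gt0)//;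
    rewrite lerXn2r ?nnegrE// ltW.
have -> : m = m0 * (1 + h) by rewrite /h addrC subrK mulrC divfK// gt_eqF.
rewrite exprMn mulrCA mulrC ler_wpM2l ?exprn_ge0 ?(ltW m0gt)//.
by rewrite ler_pdivlMl// mulrC.
Qed.

End Sequences.

(** * Smooth strongly convex functions *)

Section StronglyConvexSmooth.
Variables (R : realType) (d : nat) (f : 'cV[R]_d -> R) (mu L : R).
Implicit Types x y v : 'cV[R]_d.

Lemma derive_gradient x v : differentiable f x ->
  'D_v f x = dot (gradient f x) v.
Proof.
move=> fx; rewrite deriveE// [v in LHS]matrix_sum_delta linear_sum /dot.
apply: eq_bigr => i _; rewrite big_ord1 linearZ/= mulrC.
by rewrite /gradient mxE deriveE.
Qed.

Lemma is_derive_line x v (t : R) : (forall x, differentiable f x) ->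
  is_derive t 1 (fun s : R => f (x + s *: v)) (dot (gradient f (x + t *: v)) v).
Proof.
move=> df.
have E : (fun h : R => h^-1 *: (((fun s : R => f (x + s *: v)) \o shift t) (h *: 1)
      - f (x + t *: v))) =
    (fun h : R => h^-1 *: ((f \o shift (x + t *: v)) (h *: v) - f (x + t *: v))).
  apply/funext => h /=; congr (_ *: (f _ - _)).
  by rewrite scalerDl [h *: 1]mulr1 addrCA.
split; first by rewrite /derivable E; exact: diff_derivable.
by rewrite /derive E -derive_gradient.
Qed.

(** Compare derivatives along the segment: [phi] below is nonincreasing. *)
Lemma smooth_descent x v : smooth L f ->
  f (x + v) <= f x + dot (gradient f x) v + L / 2 * dot v v.
Proof.
move=> [df Lf].
pose c := dot (gradient f x) v; pose N := dot v v.
pose phi (t : R) := f (x + t *: v) - (c * t + L / 2 * N * t ^+ 2).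
have dphi (t : R) : is_derive t 1 phi
    (dot (gradient f (x + t *: v)) v - (c + L * N * t)).
  have := is_derive_line x v t df => dl.
  by apply: is_deriveB; apply: is_derive_eq; rewrite /GRing.scale/=; field.
have : phi 1 <= phi 0.
  apply: (@ler0_derive1_le_cc _ phi 0 1) => //; rewrite ?in_itv/= ?lexx ?ler01//.
  - move=> t; rewrite in_itv/= => /andP[t0 t1].
    rewrite derive1E derive_val.
    have -> : dot (gradient f (x + t *: v)) v =
        c + dot (gradient f (x + t *: v) - gradient f x) v.
      by rewrite dotBl -/c [RHS]addrC subrK.
    have h1 := dot_le_enorm (gradient f (x + t *: v) - gradient f x) v.
    have h2 := Lf (x + t *: v) x.
    rewrite [X in enorm (X - x)]addrC addrK enormZ gtr0_norm// in h2.
    have h3 := ler_wpM2r (enorm_ge0 v) h2.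
    have h4 := enorm_sqr v; rewrite -/N in h4.
    have : enorm v ^+ 2 * (t * L) = N * (t * L) by rewrite h4.
    lra.
  - apply: derivable_within_continuous => t _; exact: ex_derive.
rewrite /phi scale1r scale0r addr0 -/c -/N; lra.
Qed.

(** Divide the strong convexity inequality by [h] and let [h] tend to [0+]. *)
Lemma strongly_convex_lower x v :
  (forall x, differentiable f x) -> strongly_convex mu f ->
  f x + dot (gradient f x) v + mu / 2 * dot v v <= f (x + v).
Proof.
move=> df sc; rewrite -derive_gradient//.
suff : 'D_v f x <= f (x + v) - f x - mu / 2 * dot v v by lra.
have cl : (fun h : R => h^-1 *: ((f \o shift x) (h *: v) - f x)) @ 0^'+ --> 'D_v f x.
  by apply: cvg_dnbhs_at_right; apply: diff_derivable.
have cr : (fun h : R => f (x + v) - f x - mu / 2 * dot v v + mu / 2 * dot v v * h)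
     @ 0^'+ --> f (x + v) - f x - mu / 2 * dot v v.
  rewrite -[X in _ --> X]addr0 -[X in _ --> _ + X](mulr0 (mu / 2 * dot v v)).
  apply: cvg_at_right_filter; apply: cvgD; first exact: cvg_cst.
  apply: cvgM; [exact: cvg_cst|exact: cvg_id].
apply: (ler_cvg_to cl cr); near=> h.
have h0 : 0 < h by near: h; exact: nbhs_right_gt.
have h1 : h <= 1 by near: h; apply: nbhs_right_le.
have := sc (x + v) x h; rewrite (ltW h0) h1 => /(_ isT).
have -> : h *: (x + v) + (1 - h) *: x = h *: v + x.
  by rewrite scalerDr scalerBl scale1r addrC addrA subrK addrC.
rewrite [X in enorm (X - x)]addrC addrK enorm_sqr /= => sch.
rewrite [_ *: _]mulrC ler_pdivrMr//; lra.
Unshelve. all: by end_near. Qed.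

Hypothesis fS : smooth L f.
Hypothesis fC : strongly_convex mu f.

Lemma strong_convexity_le_smoothness : (0 < d)%N -> mu <= L.
Proof.
move=> d0; pose e : 'cV[R]_d := const_mx 1.
have e0 : 0 < dot e e.
  rewrite /dot (eq_bigr (fun=> 1)) => [|i _]; last by rewrite !mxE mulr1.
  by rewrite sumr_const card_ord ltr0n.
have h1 := strongly_convex_lower 0 e fS.1 fC; have h2 := smooth_descent 0 e fS.
by rewrite -(ler_pM2r e0); lra.
Qed.

(** The lower bound from [x] and the upper bound from [y], both at the point
[y - s *: (G - mu *: D)]. *)
Lemma strongly_convex_gap x y D G s :
  y - x = D -> gradient f y - gradient f x = G ->
  dot (gradient f x) D + mu / 2 * dot D D
    + (s - (L - mu) / 2 * s ^+ 2) * dot (G - mu *: D) (G - mu *: D) <= f y - f x.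
Proof.
(* the differences are named by opaque variables: only bilinearity of [dot] in
   these variables is used *)
move=> yx gyx; have [delta dE] : exists delta, G - mu *: D = delta by eexists.
rewrite dE.
have h1 := strongly_convex_lower x (D - s *: delta) fS.1 fC.
have h2 := smooth_descent y (- (s *: delta)) fS.
have e : x + (D - s *: delta) = y - s *: delta.
  by rewrite -yx addrA [x + _]addrC subrK.
rewrite e in h1; have := le_trans h1 h2.
have -> : dot (gradient f y) (- (s *: delta)) =
    - s * dot (gradient f x) delta - s * dot G delta.
  by rewrite -scaleNr dotZr -gyx dotBl; ring.
have -> : dot G delta = dot delta delta + mu * dot D delta.
  by rewrite -[in dot delta delta]dE dotBl dotZl dE subrK.
have -> : dot (- (s *: delta)) (- (s *: delta)) = s ^+ 2 * dot delta delta.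
  by rewrite -scaleNr dotZl dotZr; ring.
have -> : dot (D - s *: delta) (D - s *: delta) =
    dot D D - 2 * s * dot D delta + s ^+ 2 * dot delta delta.
  by rewrite dotBl !dotBr !dotZl !dotZr (dotC delta D); ring.
rewrite dotBr dotZr; lra.
Qed.

(** Add [strongly_convex_gap] for [(x, y)] and for [(y, x)], with
[s = (L - mu)^-1]; when [L = mu], large values of [s] force
[G = mu *: D]. *)
Lemma strongly_convex_cocoercive x y D G : (0 < d)%N ->
  y - x = D -> gradient f y - gradient f x = G ->
  mu * L * dot D D + dot G G <= (L + mu) * dot G D.
Proof.
move=> d0 yx gyx; have muL := strong_convexity_le_smoothness d0.
have dnn (u : 'cV[R]_d) : dot (- u) (- u) = dot u u.
  by rewrite -scaleN1r dotZl dotZr; ring.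
have [delta dE] : exists delta, G - mu *: D = delta by eexists.
have dD : dot delta D = dot G D - mu * dot D D by rewrite -dE dotBl dotZl.
have ddE : dot delta delta = dot G G - 2 * mu * dot G D + mu ^+ 2 * dot D D.
  by rewrite -dE dotBl !dotBr !dotZl !dotZr (dotC D G); ring.
have key s : (2 * s - (L - mu) * s ^+ 2) * dot delta delta <= dot delta D.
  have h1 := strongly_convex_gap s yx gyx; rewrite dE in h1.
  have xy : x - y = - D by rewrite -yx opprB.
  have gxy : gradient f x - gradient f y = - G by rewrite -gyx opprB.
  have := strongly_convex_gap s xy gxy.
  have -> : - G - mu *: - D = - delta by rewrite scalerN -opprD dE.
  have -> : dot (gradient f y) (- D) = - dot (gradient f y) D.
    by rewrite dotC dotNl dotC.
  have GD : dot G D = dot (gradient f y) D - dot (gradient f x) D.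
    by rewrite -gyx dotBl.
  rewrite !dnn dD GD; lra.
have dd := dot_ge0 delta.
have : dot delta delta <= (L - mu) * dot delta D.
  have [M0|M0] := ltP 0 (L - mu).
    have := key (L - mu)^-1.
    have -> : 2 * (L - mu)^-1 - (L - mu) * (L - mu)^-1 ^+ 2 = (L - mu)^-1.
      by field; rewrite gt_eqF.
    by rewrite mulrC ler_pdivrMr// mulrC.
  have M00 : L - mu = 0 by lra.
  have [dd0|] := ltP 0 (dot delta delta); last by rewrite M00; lra.
  have := key ((dot delta D + 1) / (2 * dot delta delta)).
  rewrite M00 mul0r subr0.
  have -> : 2 * ((dot delta D + 1) / (2 * dot delta delta)) * dot delta delta
    = dot delta D + 1 by field; rewrite gt_eqF.
  lra.
rewrite dD ddE; lra.
Qed.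

Lemma gradient_step_contraction x y s : (0 < d)%N -> 0 < mu ->
  0 <= s <= 2 / (L + mu) ->
  enorm (x - y - s *: (gradient f x - gradient f y))
    <= (1 - s * (mu * L / (L + mu))) * enorm (x - y).
Proof.
move=> d0 mu0 /andP[s0 s1]; have muL := strong_convexity_le_smoothness d0.
have Lm : 0 < L + mu by lra.
have [D DE] : exists D, x - y = D by eexists.
have [G GE] : exists G, gradient f x - gradient f y = G by eexists.
have co := strongly_convex_cocoercive d0 DE GE; rewrite DE GE.
pose k := mu * L / (L + mu).
have sk : s * k <= 1.
  have : s * (L + mu) <= 2 by rewrite -ler_pdivlMr.
  rewrite /k mulrA ler_pdivrMr// mul1r; nra.
rewrite -/k enormE -[leRHS]ger0_norm; last first.
  by rewrite mulr_ge0 ?enorm_ge0// subr_ge0.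
rewrite -sqrtr_sqr ler_wsqrtr// exprMn enorm_sqr.
rewrite dotBl !dotBr !dotZl !dotZr (dotC D G).
have co' : k * dot D D + dot G G / (L + mu) <= dot G D.
  rewrite /k mulrAC -mulrDl ler_pdivrMr// mulrC [dot G D * _]mulrC; lra.
have h1 : s * dot G G <= 2 / (L + mu) * dot G G by rewrite ler_wpM2r ?dot_ge0.
have h2 := ler_wpM2l s0 h1; have h3 := ler_wpM2l s0 co'.
have h4 : 0 <= (s * k) ^+ 2 * dot D D by rewrite mulr_ge0 ?sqr_ge0 ?dot_ge0.
lra.
Qed.

End StronglyConvexSmooth.

(** * Minima and maxima of finite families *)

Section Extrema.
Variables (R : realType) (n : nat) (F : 'I_n -> R).
Hypothesis n_gt0 : (0 < n)%N.

Lemma min_of_attained : exists2 k, min_of F = F k & forall j, min_of F <= F j.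
Proof.
pose k := [arg min_(i < Ordinal n_gt0) F i]%O.
have kmin j : F k <= F j by rewrite /k; case: arg_minP => // i _; exact.
have lb : lbound (range F) (F k) by move=> _ [j _ <-].
have E : min_of F = F k.
  apply/eqP; rewrite eq_le; apply/andP; split.
    by apply: ge_inf; [exists (F k)|exists k].
  by apply: lb_le_inf => //; exists (F k), k.
by exists k => // j; rewrite E.
Qed.

Lemma le_max_of j : F j <= max_of F.
Proof.
pose k := [arg max_(i > Ordinal n_gt0) F i]%O.
have kmax i : F i <= F k by rewrite /k; case: arg_maxP => // i' _; exact.
by apply: ub_le_sup; [exists (F k) => _ [i _ <-]|exists j].
Qed.

End Extrema.

(** * Quadratic functions *)

Section SymmetricPSD.
Variables (R : realType) (d : nat) (A : 'M[R]_d).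
Hypothesis Asym : A^T = A.
Hypothesis Apsd : psd A.
Implicit Types x y : 'cV[R]_d.

Lemma dotE x y : dot x y = (x^T *m y) ord0 ord0.
Proof. by rewrite mxE; apply: eq_bigr => i _; rewrite mxE. Qed.

Lemma dot_mulmx_sym x y : dot (A *m x) y = dot (A *m y) x.
Proof.
by rewrite dotE trmx_mul Asym [RHS]dotC [RHS]dotE mulmxA.
Qed.

Lemma psd_form_mulmx : psd_form (fun x y => dot (A *m x) y).
Proof.
split=> [x y|c x y z|x]; first exact: dot_mulmx_sym.
  by rewrite mulmxDr -scalemxAr dotDl dotZl.
by rewrite dotC dotE mulmxA.
Qed.

(** At a maximizer [c] of the Rayleigh quotient, with value [l], the form
[l <x, y> - <A x, y>] is positive semidefinite and vanishes at [(c, c)], so by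
Cauchy-Schwarz [c] is in its kernel, that is [A c = l c]. *)
Lemma Rayleigh_max_eigenvalue : (0 < d)%N ->
  exists2 l, eigenvalue A l & forall x, dot (A *m x) x <= l * dot x x.
Proof.
move=> d0.
(* the unit sphere of row vectors, matching the convention of [eigenvalue] *)
pose S := [set u : 'rV[R]_d | dot u^T u^T = 1].
have cq (M : 'M[R]_d) : continuous (fun u : 'rV[R]_d => dot (M *m u^T) u^T).
  rewrite /dot; apply: continuous_big => [|i _]; first exact: add_continuous.
  have cr : continuous (fun v : 'rV[R]_d => v^T i ord0).
    have -> : (fun v : 'rV[R]_d => v^T i ord0) = (fun v => v ord0 i).
      by apply/funext => x; rewrite mxE.
    exact: coord_continuous.
  have cl : continuous (fun v : 'rV[R]_d => (M *m v^T) i ord0).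
    have -> : (fun v : 'rV[R]_d => (M *m v^T) i ord0) =
        (fun v => \sum_j M i j * v ord0 j).
      by apply/funext => x; rewrite mxE; apply: eq_bigr => j _; rewrite mxE.
    apply: continuous_big => [|j _ v]; first exact: add_continuous.
    have cc := @coord_continuous R 1 d ord0 j v.
    exact: (cvgMl_tmp cc).
  by move=> u; exact: (cvgM (cl u) (cr u)).
have dot1 : (fun u : 'rV[R]_d => dot u^T u^T) = (fun u => dot (1%:M *m u^T) u^T).
  by apply/funext => u; rewrite mul1mx.
have S0 : S !=set0.
  exists (delta_mx ord0 (Ordinal d0)); rewrite /S/= /dot (bigD1 (Ordinal d0))//=.
  rewrite !mxE !eqxx mulr1 big1 ?addr0// => i iN.
  by rewrite !mxE (negbTE iN) andbF mulr0.
have Sc : compact S.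
  apply: bounded_closed_compact.
    exists 1; split; first exact: num_real.
    move=> M M1 u Su; rewrite /= [leLHS]/Num.norm/= mx_normrE.
    apply: bigmax_le => [|[i j] _]; first by lra.
    rewrite (ord1 i) /= -[u]trmxK mxE.
    apply: (le_trans (enorm_entry _ _ _)).
    by rewrite enormE Su sqrtr1 ltW.
  have /continuous_closedP/(_ _ (@closed_eq _ 1)) := cq 1%:M.
  by rewrite -dot1; exact.
have [c] := compact_EVT_max S0 Sc (continuous_subspaceT (cq A)).
rewrite inE => cS cmax.
pose l := dot (A *m c^T) c^T.
have lmax x : dot (A *m x) x <= l * dot x x.
  have [x0|x0] := leP (dot x x) 0.
    have xn : enorm x = 0 by rewrite enormE; apply/eqP; rewrite sqrtr_eq0.
    have -> : dot x x = 0 by apply/eqP; rewrite eq_le x0 dot_ge0.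
    by have := dot_le_enorm (A *m x) x; rewrite xn !mulr0.
  pose e := (enorm x)^-1.
  have e2 : e ^+ 2 * dot x x = 1.
    by rewrite /e -enorm_sqr exprVn mulVf// enorm_sqr gt_eqF.
  have := cmax (e *: x)^T; rewrite inE /S/= trmxK dotZl dotZr mulrA -expr2 e2.
  move=> /(_ erefl); rewrite -scalemxAr dotZl dotZr mulrA -expr2 -/l => h.
  have := ler_wpM2r (dot_ge0 x) h; rewrite mulrAC e2 mul1r; exact.
exists l => //.
have psdB : psd_form (fun x y => l * dot x y - dot (A *m x) y).
  split=> [x y|a x y z|x].
  - by rewrite dotC dot_mulmx_sym.
  - by rewrite mulmxDr -scalemxAr !dotDl !dotZl; ring.
  - by rewrite subr_ge0.
have lc : l *: c^T - A *m c^T = 0.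
  set r := l *: c^T - A *m c^T.
  have := psd_form_CauchySchwarz psdB c^T r.
  rewrite cS mulr1 -/l subrr mul0r -dotZl -dotBl -/r => r2.
  have r0 : dot r r = 0 by apply/eqP; rewrite -sqrf_eq0 eq_le r2 sqr_ge0.
  apply/matrixP => i j; rewrite [RHS]mxE; apply/eqP; rewrite -normr_le0.
  by rewrite (le_trans (enorm_entry _ _ _))// enormE r0 sqrtr0.
apply/eigenvalueP; exists c.
  apply: trmx_inj; rewrite trmx_mul Asym linearZ/=.
  by apply/esym/eqP; rewrite -subr_eq0 lc.
apply/eqP => c0; move: cS; rewrite /S/= c0 trmx0 dot0l => /eqP.
by rewrite eq_sym oner_eq0.
Qed.

(** Cauchy-Schwarz for the form [<A x, y>] at [(x, A x)], then the Rayleigh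
bound at [x] and at [A x]. *)
Lemma psd_mulmx_le_largest_eigenvalue l x : (0 < d)%N ->
  largest_eigenvalue A l -> 0 <= l /\ enorm (A *m x) <= l * enorm x.
Proof.
move=> d0 [evl lmax].
have [l' evl' Rl'] := Rayleigh_max_eigenvalue d0.
have Ray y : dot (A *m y) y <= l * dot y y.
  by rewrite (le_trans (Rl' y))// ler_wpM2r ?dot_ge0// lmax.
have l0 : 0 <= l.
  have [v vA v0] := eigenvalueP evl.
  have : A *m v^T = l *: v^T by rewrite -{1}Asym -trmx_mul vA linearZ.
  have := psd_form_mulmx => -[_ _ /(_ v^T)] /[swap] ->.
  rewrite dotZl pmulr_lge0// lt_neqAle dot_ge0 andbT eq_sym; apply: contraNneq v0 => vv.
  apply/eqP/matrixP => i j; rewrite [RHS]mxE; apply/eqP; rewrite -normr_le0.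
  have := enorm_entry v^T j i; rewrite mxE enormE vv sqrtr0; exact.
split=> //.
set y := A *m x.
have := psd_form_CauchySchwarz psd_form_mulmx x y; rewrite -/y => cs.
have h1 := Ray x; have h2 := Ray y; rewrite -/y in h1.
have y0 := dot_ge0 y; have x0 := dot_ge0 x.
have p1 : 0 <= dot y x by have [_ _] := psd_form_mulmx; exact.
have p2 : 0 <= dot (A *m y) y by have [_ _] := psd_form_mulmx; exact.
have h3 := ler_pM p1 p2 h1 h2.
have h4 : dot y y <= l ^+ 2 * dot x x.
  have [yy|yy] := ltP 0 (dot y y).
    rewrite -(ler_pM2r yy) -expr2; lra.
  by rewrite (le_trans yy)// mulr_ge0// sqr_ge0.
rewrite -(ger0_norm l0) -enormZ !enormE ler_wsqrtr// dotZl dotZr; lra.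
Qed.

Lemma gradient_quadratic (B : 'rV[R]_d) (f : 'cV[R]_d -> R) :
  (forall x, f x = 1 / 2 * (x^T *m A *m x) ord0 ord0 + (B *m x) ord0 ord0) ->
  forall x, gradient f x = A *m x + B^T.
Proof.
move=> fE x.
have fE' z : f z = 1 / 2 * dot (A *m z) z + dot B^T z.
  by rewrite fE [dot (_ *m _) _]dotC !dotE trmxK mulmxA.
apply/matrixP => i j; rewrite (ord1 j) /gradient mxE.
set e : 'cV[R]_d := delta_mx i ord0.
have dote (z : 'cV[R]_d) : dot z e = z i ord0.
  rewrite /dot (bigD1 i)//= !mxE !eqxx mulr1 big1 ?addr0// => k kN.
  by rewrite mxE (negbTE kN) mulr0.
rewrite -dote.
apply: cvg_lim => //.
apply: (@cvg_trans _ ((fun h : R => dot (A *m x + B^T) e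
   + 1 / 2 * dot (A *m e) e * h) @ 0^')).
  apply: near_eq_cvg; near=> h.
  have h0 : h != 0 by near: h; exact: nbhs_dnbhs_neq.
  rewrite /= !fE' mulmxDr -scalemxAr !dotDl !dotDr !dotZl !dotZr.
  rewrite (dot_mulmx_sym e x) /GRing.scale/=; field.
  exact: h0.
have cm : (fun h : R => 1 / 2 * dot (A *m e) e * h) @ 0^' --> (0 : R).
  rewrite -[X in _ --> X](mulr0 (1 / 2 * dot (A *m e) e)).
  apply: cvg_within_filter; apply: cvgM; [exact: cvg_cst|exact: cvg_id].
have := cvgD (cvg_cst (dot (A *m x + B^T) e)) cm; rewrite addr0; exact.
Unshelve. all: by end_near. Qed.

End SymmetricPSD.

(** * Averaging by a column stochastic matrix *)

Section Mixing.
Variables (R : realType) (n d : nat) (W : 'M[R]_n) (p : 'cV[R]_n).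
Implicit Types w v : blocks R n d.

Lemma JmapB w v : Jmap W (w - v) = Jmap W w - Jmap W v.
Proof.
apply/funext => k; rewrite /Jmap -[RHS]/(_ - _) -sumrB.
by apply: eq_bigr => j _; rewrite -scalerBr.
Qed.

Lemma JmapD w v : Jmap W (w + v) = Jmap W w + Jmap W v.
Proof.
apply/funext => k; rewrite /Jmap -[RHS]/(_ + _) -big_split/=.
by apply: eq_bigr => j _; rewrite -scalerDr.
Qed.

Lemma JmapZ c w : Jmap W (c *: w) = c *: Jmap W w.
Proof.
apply/funext => k; rewrite /Jmap -[RHS]/(c *: _) scaler_sumr.
by apply: eq_bigr => j _; rewrite !scalerA mulrC -scalerA.
Qed.

Hypothesis p_gt0 : forall j, 0 < p j ord0.
Hypothesis W_ge0 : forall i j, 0 <= W i j.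
Hypothesis W_col : forall j, \sum_(k < n) W k j = 1.
Hypothesis Wp : W *m p = p.

(** Expand the nonnegative variance of [x j / p j] under the weights
[W k j * p j], whose total mass is [p k]. *)
Lemma weighted_Jensen (x : 'I_n -> R) k :
  (p k ord0)^-1 * (\sum_j W k j * x j) ^+ 2
    <= \sum_j W k j * ((p j ord0)^-1 * x j ^+ 2).
Proof.
set S := \sum_j W k j * x j.
have pk : \sum_j W k j * p j ord0 = p k ord0 by rewrite -[in RHS]Wp mxE.
have pk0 : p k ord0 != 0 by rewrite gt_eqF.
pose m := S / p k ord0.
have: 0 <= \sum_j W k j * (p j ord0 * ((p j ord0)^-1 * x j - m) ^+ 2).
  apply: sumr_ge0 => j _; apply: mulr_ge0 => //.
  by apply: mulr_ge0; rewrite ?sqr_ge0 ?(ltW (p_gt0 j)).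
have -> : \sum_j W k j * (p j ord0 * ((p j ord0)^-1 * x j - m) ^+ 2) =
    \sum_j W k j * ((p j ord0)^-1 * x j ^+ 2) - 2 * m * S + m ^+ 2 * p k ord0.
  rewrite -pk /S !mulr_sumr -sumrB -big_split/=; apply: eq_bigr => j _.
  have pj0 : p j ord0 != 0 by rewrite gt_eqF.
  by field.
have -> : (p k ord0)^-1 * S ^+ 2 = m * S by rewrite /m; field.
have -> : m ^+ 2 * p k ord0 = m * S by rewrite /m; field.
lra.
Qed.

Lemma Jmap_nonexpansive w : bnorm p (Jmap W w) <= bnorm p w.
Proof.
rewrite /bnorm ler_wsqrtr//.
under eq_bigr => k _ do rewrite enorm_sqr.
under [leRHS]eq_bigr => k _ do rewrite enorm_sqr.
have -> : \sum_(j < n) (p j ord0)^-1 * dot (w j) (w j) =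
    \sum_(k < n) \sum_(i < d) \sum_(j < n)
      W k j * ((p j ord0)^-1 * w j i ord0 ^+ 2).
  under [RHS]eq_bigr => k _ do rewrite exchange_big/=.
  rewrite [RHS]exchange_big/=; apply: eq_bigr => j _.
  transitivity (\sum_(k < n) W k j * ((p j ord0)^-1 * dot (w j) (w j))).
    by rewrite -mulr_suml W_col mul1r.
  apply: eq_bigr => k _; rewrite /dot !mulr_sumr.
  by apply: eq_bigr => i _; rewrite expr2.
apply: ler_sum => k _; rewrite /dot mulr_sumr; apply: ler_sum => i _.
rewrite -expr2 /Jmap summxE.
under eq_bigr => j _ do rewrite mxE.
exact: weighted_Jensen.
Qed.

(** The gradients at the blocks rescaled by [s]: T_alpha uses
[s j = (n pi_j)^-1], the iteration uses [s j = y_j(t)^-1]. *)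
Definition scaled_gradient (f : 'I_n -> 'cV[R]_d -> R) (s : 'I_n -> R) w
  : blocks R n d := fun j => gradient (f j) (s j *: w j).

Lemma TmapE (f : 'I_n -> 'cV[R]_d -> R) alpha w : Tmap W p f alpha w =
  Jmap W (w - alpha *: scaled_gradient f (fun j => (n%:R * p j ord0)^-1) w).
Proof. by []. Qed.

Lemma gradient_pushS (f : 'I_n -> 'cV[R]_d -> R) alpha w0 t :
  gradient_push W f alpha w0 t.+1 =
  Jmap W (gradient_push W f alpha w0 t -
    alpha *: scaled_gradient f (fun j => (push_sum W t j ord0)^-1)
               (gradient_push W f alpha w0 t)).
Proof. by []. Qed.

End Mixing.

(** * The contraction principle in the weighted block norm *)

(** Matrices with real entries are a complete normed module, so that the Picard
iterates of each block converge as soon as their increments are summable. *)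
HB.instance Definition _ (R : realType) m n := Complete.on 'M[R]_(m, n).

Section FixedPoint.
Variables (R : realType) (n d : nat) (p : 'cV[R]_n).
Hypothesis p_gt0 : forall j, 0 < p j ord0.
Variables (T : blocks R n d -> blocks R n d) (q : R).
Hypothesis q01 : 0 < q < 1.
Hypothesis Tq : forall x y, bnorm p (T x - T y) <= q * bnorm p (x - y).

Lemma contraction_fixpoint_unique_bnorm x y : T x = x -> T y = y -> x = y.
Proof.
move=> Tx Ty; apply/eqP; rewrite -subr_eq0; apply/eqP.
apply: (bnorm_eq0 p_gt0); have := Tq x y; rewrite Tx Ty.
have := bnorm_ge0 p (x - y); set X := bnorm p _ => X0 Xq; case/andP: q01 => _ q1.
by rewrite -(pmulr_rle0 X (_ : 0 < 1 - q)) ?subr_gt0//; lra.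
Qed.

Lemma cvg_le_geometric (V : completeNormedModType R) (u : nat -> V) (D : R) :
  (forall m, `|u m.+1 - u m| <= D * q ^+ m) -> cvgn u.
Proof.
move=> h.
have q1 : `|q| < 1 by case/andP: q01 => q0 ?; rewrite gtr0_norm.
have -> : u = (fun m => u 0%N + series (fun m => u m.+1 - u m) m).
  by apply/funext => m; rewrite /series/= telescope_sumr// addrC subrK.
apply: is_cvgD; first exact: is_cvg_cst.
apply: normed_cvg; apply: (@series_le_cvg _ _ (geometric D q)) => //=.
  by move=> m; rewrite (le_trans _ (h m)).
exact: is_cvg_geometric_series.
Qed.

(** The Picard iterates converge blockwise, since [bnorm p] dominates the norm of
each block, and then in [bnorm p], since there are finitely many blocks. *)
Lemma contraction_fixpoint_exists : exists x, T x = x.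
Proof.
case/andP: (q01) => q0 q1.
pose x m := iter m T 0; pose D := bnorm p (x 1%N - x 0%N).
have xS m : bnorm p (x m.+1 - x m) <= D * q ^+ m.
  elim: m => [|m IH]; first by rewrite expr0 mulr1.
  by apply: (le_trans (Tq _ _)); rewrite exprS mulrCA ler_wpM2l// ltW.
have xc k : cvgn (fun m => x m k).
  apply: (@cvg_le_geometric 'cV[R]_d _ (Num.sqrt (p k ord0) * D)) => m.
  have := bnorm_block_norm p_gt0 (x m.+1 - x m) k => /le_trans; apply.
  by rewrite -mulrA ler_wpM2l ?sqrtr_ge0.
pose z : blocks R n d := fun k => limn (fun m => x m k).
exists z; apply/eqP; rewrite -subr_eq0; apply/eqP; apply: (bnorm_eq0 p_gt0).
pose c := Num.sqrt (\sum_j (p j ord0)^-1 * d%:R).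
have c0 : 0 <= c by exact: sqrtr_ge0.
apply/ler_addgt0Pr => e e0; rewrite add0r.
(* makes the total error (q + 1) e' c at most e *)
pose e' := e / (2 * (c + 1)).
have e'0 : 0 < e' by rewrite divr_gt0//; lra.
have [m [xm xm1]] : exists m, (forall k, `|(x m - z) k| <= e') /\
                              (forall k, `|(x m.+1 - z) k| <= e').
  have [N _ hN] : \forall m \near \oo, forall k, `|(x m - z) k| <= e'.
    apply: filter_forall => k.
    have /cvgrPdist_le/(_ _ e'0) := xc k.
    by apply: filterS => m; rewrite distrC.
  by exists N; split; apply: hN => /=.
have b1 := bnorm_le_norm p_gt0 (ltW e'0) xm.
have b2 := bnorm_le_norm p_gt0 (ltW e'0) xm1.
have := bnormD p_gt0 (T z - T (x m)) (x m.+1 - z).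
have -> : T z - T (x m) + (x m.+1 - z) = T z - z by rewrite addrA subrK.
move=> /le_trans; apply.
have h1 := Tq z (x m); rewrite (bnorm_distC p_gt0 z) in h1.
have h0 := bnorm_ge0 p (x m - z).
have ee : e' * (c + 1) = e / 2 by rewrite /e'; field; lra.
rewrite -/c in b1 b2.
set X := bnorm p (x m - z) in h0 h1 b1 *; set Y := bnorm p _ in h1 *.
have : q * X <= X by rewrite ler_piMl// ltW.
lra.
Qed.

End FixedPoint.

(** * Convergence of the perturbed iteration *)

(** What the convergence argument uses of the objective functions and of the
step size: T_alpha is a [1 - C alpha]-contraction, with a factor in ]0, 1[
for [alpha > 0], and the gradients are [Lm]-Lipschitz. *)
Definition contractive_step (R : realType) (n d : nat) (W : 'M[R]_n)
    (p : 'cV[R]_n) (f : 'I_n -> 'cV[R]_d -> R) (alpha C Lm : R) : Prop :=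
  [/\ 0 < C, 0 < 1 - C * alpha, 0 <= Lm,
      (forall x y : blocks R n d,
        bnorm p (Tmap W p f alpha x - Tmap W p f alpha y)
          <= (1 - C * alpha) * bnorm p (x - y)) &
      (forall j x y, enorm (gradient (f j) x - gradient (f j) y)
          <= Lm * enorm (x - y))].

Section PushSumGradient.
Variables (R : realType) (n d : nat) (W : 'M[R]_n) (p : 'cV[R]_n).
Variables (f : 'I_n -> 'cV[R]_d -> R) (a alpha rho C Lm : R) (w0 : blocks R n d).
Hypothesis p_gt0 : forall j, 0 < p j ord0.
Hypothesis W_ge0 : forall i j, 0 <= W i j.
Hypothesis W_col : forall j, \sum_(k < n) W k j = 1.
Hypothesis Wp : W *m p = p.
Hypothesis rho01 : 0 < rho < 1.
Hypothesis a_gt0 : 0 < a.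
Hypothesis push_sum_rate : forall (j : 'I_n) (t : nat),
  `|(push_sum W t j ord0)^-1 - (n%:R * p j ord0)^-1| <= a * rho ^+ t.
Hypothesis alpha_gt0 : 0 < alpha.
Hypothesis step : contractive_step W p f alpha C Lm.

Let C_gt0 : 0 < C. Proof. by case: step. Qed.
Let q_gt0 : 0 < 1 - C * alpha. Proof. by case: step. Qed.
Let Lm_ge0 : 0 <= Lm. Proof. by case: step. Qed.
Let T_contr : forall x y : blocks R n d,
  bnorm p (Tmap W p f alpha x - Tmap W p f alpha y)
    <= (1 - C * alpha) * bnorm p (x - y).
Proof. by case: step. Qed.
Let gradL : forall j x y,
  enorm (gradient (f j) x - gradient (f j) y) <= Lm * enorm (x - y).
Proof. by case: step. Qed.
Let rho_gt0 : 0 < rho. Proof. by case/andP: rho01. Qed.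

Let b := a * Lm.
Let Rad := C^-1 * bnorm p (Jmap W (gradF f (0 : blocks R n d))).
Let w := gradient_push W f alpha w0.

Lemma push_sum_error t : bnorm p (w t.+1 - Tmap W p f alpha (w t))
  <= alpha * b * rho ^+ t * bnorm p (w t).
Proof.
rewrite /w gradient_pushS -/(w t) TmapE -JmapB opprB addrC addrA subrK.
rewrite -scalerBr JmapZ bnormZ// gtr0_norm// -!mulrA ler_wpM2l ?(ltW alpha_gt0)//.
apply: (le_trans (Jmap_nonexpansive p_gt0 W_ge0 W_col Wp _)).
rewrite !mulrA; apply: (ler_bnorm p_gt0) => [|j].
  by rewrite mulr_ge0 ?exprn_ge0 ?mulr_ge0 ?(ltW a_gt0) ?(ltW rho_gt0).
rewrite -[X in enorm X]/(gradient _ _ - gradient _ _).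
apply: (le_trans (gradL _ _ _)); rewrite -scalerBl enormZ.
by rewrite mulrA ler_wpM2r ?enorm_ge0// distrC [a * Lm]mulrC -mulrA ler_wpM2l.
Qed.

(** Compare [v = T v] with [T 0], which is [- alpha] times the averaged gradient
at [0]. *)
Lemma fixpoint_bound v : Tmap W p f alpha v = v -> bnorm p v <= Rad.
Proof.
move=> Tv.
have := bnormD p_gt0 (Tmap W p f alpha v - Tmap W p f alpha 0)
  (Tmap W p f alpha 0).
rewrite subrK Tv; have := T_contr v 0; rewrite Tv subr0.
have -> : bnorm p (Tmap W p f alpha 0) =
    alpha * bnorm p (Jmap W (gradF f (0 : blocks R n d))).
  have -> : Tmap W p f alpha 0 = (- alpha) *: Jmap W (gradF f 0).
    rewrite TmapE -JmapZ; congr (Jmap W _); apply/funext => j.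
    rewrite -[LHS]/(0 - alpha *: gradient (f j) (_ *: 0)).
    by rewrite scaler0 sub0r -scaleNr.
  by rewrite bnormZ// normrN gtr0_norm.
set N := bnorm p (Jmap _ _); set M := bnorm p v => h1 h2.
rewrite /Rad -/N ler_pdivlMl// -(ler_pM2l alpha_gt0); lra.
Qed.

(** The errors [bnorm p (w t - walpha)] satisfy the hypothesis of
[perturbed_recursion_lim], and the other conclusions are read off from its
bound. *)
Lemma gradient_push_convergence :
  cvgn (V_partial alpha b rho C) /\
  exists walpha : blocks R n d,
    [/\ Tmap W p f alpha walpha = walpha,
        (forall v : blocks R n d, Tmap W p f alpha v = v -> v = walpha),
        (forall k : 'I_n, (fun t => w t k) @ \oo --> walpha k),
        (exists K q : R, 0 < q < 1 /\
           forall t : nat, bnorm p (w t - walpha) <= K * q ^+ t) &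
        (forall t : nat,
           bnorm p (w t.+1 - walpha) <=
             V_of alpha b rho C * (1 - C * alpha) ^+ t.+1 * bnorm p (w0 - walpha)
             + remainder alpha b rho C Rad t)].
Proof.
have b_ge0 : 0 <= alpha * b by rewrite !mulr_ge0// ltW.
pose q := 1 - C * alpha; rewrite -/q.
have q01 : 0 < q < 1 by rewrite q_gt0/= gtrBl mulr_gt0.
have Tq : forall x y, _ <= q * _ := T_contr.
have [rho0 rho1] := andP rho01.
have Rad_ge0 : 0 <= Rad by rewrite mulr_ge0 ?bnorm_ge0// invr_ge0 ltW.
split; first exact: (infl_cvg b_ge0 q01 rho01).
have [v Tv] := contraction_fixpoint_exists p_gt0 q01 Tq.
have recur t : bnorm p (w t.+1 - v) <=
    (q + alpha * b * rho ^+ t) * bnorm p (w t - v) + alpha * b * Rad * rho ^+ t.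
  have := bnormD p_gt0 (w t.+1 - Tmap W p f alpha (w t)) (Tmap W p f alpha (w t) - v).
  rewrite addrA subrK => /le_trans; apply.
  have h1 := push_sum_error t; have h2 := Tq (w t) v; rewrite Tv in h2.
  have h3 := bnormD p_gt0 (w t - v) v; rewrite subrK in h3.
  have h4 := fixpoint_bound Tv.
  have h5 : 0 <= alpha * b * rho ^+ t by rewrite mulr_ge0// exprn_ge0// ltW.
  have := ler_wpM2l h5 (le_trans h3 (lerD (lexx _) h4)); lra.
have main := perturbed_recursion_lim b_ge0 q01 rho01 Rad_ge0 (bnorm_ge0 _ _) recur.
have VE : infl_lim (alpha * b) q rho = V_of alpha b rho C by [].
set V := infl_lim _ _ _ in main VE.
have rate : exists K r : R, 0 < r < 1 /\
    forall t : nat, bnorm p (w t - v) <= K * r ^+ t.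
  have [K [m [K0 m01 qm rm hK]]] := geometric_convolution_rate q01 rho01.
  have [m0 m1] := andP m01.
  have V0 : 0 <= V.
    apply: le_trans (infl_le_lim b_ge0 q01 rho01 0 0); exact: infl_ge0.
  set e := fun t => bnorm p (w t - v) in main.
  pose K' := e 0%N + V * e 0%N + V * (alpha * b) * Rad * K / m + alpha * b * Rad / m.
  exists K', m; split=> // -[|t].
    rewrite expr0 mulr1 /K' -!addrA lerDl.
    by rewrite !addr_ge0// !mulr_ge0 ?bnorm_ge0 ?invr_ge0//; exact: ltW.
  apply: (le_trans (main t)).
  have qmt : q ^+ t.+1 <= m ^+ t.+1 by rewrite lerXn2r ?nnegrE// ltW.
  have rmt : rho ^+ t <= m ^+ t by rewrite lerXn2r ?nnegrE// ltW.
  have mt : m ^+ t = m ^+ t.+1 / m by rewrite exprS mulrC mulKf// gt_eqF.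
  rewrite mt in rmt; have hKt := hK t; rewrite mt in hKt.
  have e0 : 0 <= e 0%N by exact: bnorm_ge0.
  have A1 := ler_wpM2l (mulr_ge0 V0 e0) qmt.
  have c2 : 0 <= V * (alpha * b) * Rad by apply: mulr_ge0 => //; exact: mulr_ge0.
  have A2 := ler_wpM2l c2 hKt.
  have A3 := ler_wpM2l (mulr_ge0 b_ge0 Rad_ge0) rmt.
  have A4 : 0 <= e 0%N * m ^+ t.+1 by rewrite mulr_ge0// exprn_ge0// ltW.
  rewrite /K' !mulrDl.
  have -> : V * (alpha * b) * Rad * K / m * m ^+ t.+1 =
     V * (alpha * b) * Rad * (K * (m ^+ t.+1 / m)) by ring.
  have -> : alpha * b * Rad / m * m ^+ t.+1 = alpha * b * Rad * (m ^+ t.+1 / m) by ring.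
  rewrite -[bnorm p (w 0 - v)]/(e 0%N); lra.
exists v; split => //.
- by move=> v' Tv'; exact: (contraction_fixpoint_unique_bnorm p_gt0 q01 Tq).
- move=> k; have [K [r [r01 hK]]] := rate.
  apply/cvgrPdist_le => e e0.
  have s0 : 0 <= Num.sqrt (p k ord0) by exact: sqrtr_ge0.
  have cv : (fun t => Num.sqrt (p k ord0) * K * r ^+ t) @ \oo --> (0 : R).
    by apply: cvg_geometric; case/andP: r01 => r0 r1; rewrite gtr0_norm.
  have /cvgrPdist_le/(_ _ e0) := cv; apply: filterS => t; rewrite sub0r normrN.
  move=> /(le_trans (ler_norm _)); apply: le_trans.
  have := bnorm_block_norm p_gt0 (w t - v) k; rewrite distrC => /le_trans; apply.
  by rewrite -mulrA ler_wpM2l.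
- move=> t; apply: (le_trans (main t)); rewrite -/V -VE.
  rewrite -addrA lerD2l geometric_convolution /remainder -/q -VE le_eqVlt.
  apply/orP; left; apply/eqP; case: ifP => [/eqP|] qr; last first.
    rewrite -/V; congr (_ + _); ring.
  rewrite -/V; ring.
Qed.

End PushSumGradient.

(** * The two cases *)

Section Cases.
Variables (R : realType) (n d : nat) (W : 'M[R]_n) (p : 'cV[R]_n).
Variables (f : 'I_n -> 'cV[R]_d -> R) (L : 'I_n -> R) (alpha0 C alpha : R).
Hypothesis n_gt0 : (0 < n)%N.
Hypothesis d_gt0 : (0 < d)%N.
Hypothesis p_gt0 : forall j, 0 < p j ord0.
Hypothesis W_ge0 : forall i j, 0 <= W i j.
Hypothesis W_col : forall j, \sum_(k < n) W k j = 1.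
Hypothesis Wp : W *m p = p.
Hypothesis alpha_gt0 : 0 < alpha.
Hypothesis alpha_le : alpha <= alpha0.

Lemma case1_contractive_step : case1 p f L alpha0 C ->
  contractive_step W p f alpha C (max_of L).
Proof.
move=> [mu [hf alpha0E CE]].
have n0 : 0 < n%:R :> R by rewrite ltr0n.
have muL k : mu k <= L k.
  have [mu0 sc sm] := hf k; exact: (strong_convexity_le_smoothness sm sc d_gt0).
have mu_gt0 k : 0 < mu k by case: (hf k).
have L_gt0 k : 0 < L k by exact: lt_le_trans (muL k).
have LM k : L k <= max_of L by exact: le_max_of.
have [kC Ck Cle] := min_of_attained
  (fun k => mu k * L k / (n%:R * (mu k + L k) * p k ord0)) n_gt0.
have [_ _ ale] := min_of_attained
  (fun k => 2 * n%:R * p k ord0 / (L k + mu k)) n_gt0.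
rewrite -CE in Ck Cle; rewrite -alpha0E in ale.
have s0 k : 0 < L k + mu k by rewrite addr_gt0.
have np k : 0 < n%:R * p k ord0 by rewrite mulr_gt0.
have C0 : 0 < C.
  by rewrite Ck divr_gt0// ?mulr_gt0// addr_gt0.
(* the step size seen by the variable x_k = w_k / (n pi_k) *)
have step k : 0 <= alpha / (n%:R * p k ord0) <= 2 / (L k + mu k).
  rewrite divr_ge0 ?(ltW alpha_gt0) ?(ltW (np k))//= ler_pdivrMr//.
  by apply: (le_trans alpha_le); apply: (le_trans (ale k)); rewrite [leRHS]mulrAC mulrA.
have CaE k : C * alpha <=
    alpha / (n%:R * p k ord0) * (mu k * L k / (L k + mu k)).
  have -> : alpha / (n%:R * p k ord0) * (mu k * L k / (L k + mu k)) =
     mu k * L k / (n%:R * (mu k + L k) * p k ord0) * alpha.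
    by field; rewrite ![_ == 0]gt_eqF//= ?addr_gt0.
  by rewrite ler_pM2r.
have q0 : 0 < 1 - C * alpha.
  (* C alpha <= 2 mu L / (L + mu)^2 <= 1 / 2 at any index *)
  pose k := Ordinal n_gt0.
  have := CaE k; have /andP[_] := step k.
  set s := alpha / _ => h1 h2; rewrite subr_gt0; apply: (le_lt_trans h2).
  have k0 : 0 < mu k * L k / (L k + mu k) by rewrite divr_gt0// mulr_gt0.
  apply: (le_lt_trans (ler_wpM2r (ltW k0) h1)).
  rewrite mulrA ltr_pdivrMr// mul1r mulrAC ltr_pdivrMr//.
  have := mulr_gt0 (mu_gt0 k) (L_gt0 k); nra.
split => //.
- exact: le_trans (ltW (L_gt0 (Ordinal n_gt0))) (LM _).
- move=> x y; rewrite !TmapE -JmapB.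
  apply: (le_trans (Jmap_nonexpansive p_gt0 W_ge0 W_col Wp _)).
  apply: (ler_bnorm p_gt0 (ltW q0)) => j.
  have [mu0 sc sm] := hf j.
  have c0 := np j.
  set c := n%:R * p j ord0 in c0.
  rewrite -[X in enorm X]/((x j - alpha *: gradient (f j) (c^-1 *: x j))
    - (y j - alpha *: gradient (f j) (c^-1 *: y j))).
  have E (X Y gX gY : 'cV[R]_d) : (X - alpha *: gX) - (Y - alpha *: gY) =
      c *: (c^-1 *: X - c^-1 *: Y - (alpha / c) *: (gX - gY)).
    rewrite [RHS]scalerBr -[c^-1 *: X - _]scalerBr !scalerA divff ?gt_eqF//.
    rewrite scale1r [c * _]mulrCA divff ?gt_eqF// mulr1 scalerBr !opprB.
    by rewrite addrACA [in RHS]addrACA [- Y + _]addrC.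
  rewrite E enormZ gtr0_norm//.
  have := gradient_step_contraction sm sc (c^-1 *: x j) (c^-1 *: y j) d_gt0 mu0 (step j).
  rewrite -(ler_pM2l c0) => /le_trans; apply.
  rewrite -scalerBr enormZ [`|c^-1|]gtr0_norm ?invr_gt0//.
  rewrite [leLHS]mulrCA [c * _]mulrA divff ?gt_eqF// mul1r.
  by rewrite ler_wpM2r ?enorm_ge0// lerB// CaE.
- move=> j x y; have [_ _ [_ sm]] := hf j.
  by rewrite (le_trans (sm x y))// ler_wpM2r ?enorm_ge0.
Qed.

Lemma case2_contractive_step : case2 W p f L alpha0 C ->
  contractive_step W p f alpha C (max_of L).
Proof.
move=> [A [B [mu [eps [eta [hA fE _ _ [/andP[eta0 eta1] Tc CE]]]]]]].
have a0 : 0 < alpha0 by exact: lt_le_trans alpha_le.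
have C0 : 0 < C by rewrite CE divr_gt0// subr_gt0.
have M0 : 0 <= max_of L.
  have [sA pA eA] := hA (Ordinal n_gt0).
  have [L0 _] := psd_mulmx_le_largest_eigenvalue sA pA 0 d_gt0 eA.
  exact: le_trans L0 (le_max_of _ n_gt0 _).
pose s := alpha / alpha0.
have s0 : 0 < s by rewrite divr_gt0.
have s1 : s <= 1 by rewrite ler_pdivrMr// mul1r.
have CaE : C * alpha = (1 - eta) * s by rewrite CE mulrAC mulrA.
(* T_alpha is the convex combination of the averaging map and T_alpha0 *)
have TE (w : blocks R n d) : Tmap W p f alpha w =
    (1 - s) *: Jmap W w + s *: Tmap W p f alpha0 w.
  rewrite !TmapE -!JmapZ -JmapD scalerBr scalerA divfK ?gt_eqF//.
  by rewrite addrA scalerBl scale1r subrK.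
rewrite /contractive_step CaE; split => //.
- by nra.
- move=> x y; rewrite !TE opprD addrACA -!scalerBr -JmapB.
  apply: (le_trans (bnormD p_gt0 _ _)).
  rewrite !bnormZ// [`|s|]gtr0_norm// ger0_norm ?subr_ge0//.
  have h1 := ler_wpM2l (ltW s0) (Tc x y).
  have s10 : 0 <= 1 - s by rewrite subr_ge0.
  have h2 := ler_wpM2l s10 (Jmap_nonexpansive p_gt0 W_ge0 W_col Wp (x - y)).
  lra.
- move=> j x y; have [sA pA eA] := hA j.
  rewrite !(gradient_quadratic sA (fE j)) opprD addrACA subrr addr0 -mulmxBr.
  have [_ /le_trans] := psd_mulmx_le_largest_eigenvalue sA pA (x - y) d_gt0 eA.
  by apply; rewrite ler_wpM2r ?enorm_ge0// le_max_of.
Qed.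

End Cases.

Theorem theorem2p5 (R : realType) (n d : nat) (E : rel 'I_n) (W : 'M[R]_n)
    (p : 'cV[R]_n) (a : R) (f : 'I_n -> 'cV[R]_d -> R) (L : 'I_n -> R)
    (alpha0 C : R) (w0 : blocks R n d) :
  (0 < d)%N ->
  strongly_connected E ->
  weight_matrix E W ->
  perron_vector W p ->
  let rho := rho_of W p in
  0 < rho < 1 ->
  0 < a ->
  (forall (j : 'I_n) (t : nat),
     `|(push_sum W t j ord0)^-1 - (n%:R * p j ord0)^-1| <= a * rho ^+ t) ->
  case1 p f L alpha0 C \/ case2 W p f L alpha0 C ->
  let b := a * max_of L in
  let Rad := C^-1 * bnorm p (Jmap W (gradF f (0 : blocks R n d))) in
  forall alpha : R, 0 < alpha <= alpha0 ->
  let V := V_of alpha b rho C in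
  let w := gradient_push W f alpha w0 in
  cvgn (V_partial alpha b rho C) /\
  exists walpha : blocks R n d,
    [/\ Tmap W p f alpha walpha = walpha,
        (forall v : blocks R n d, Tmap W p f alpha v = v -> v = walpha),
        (forall k : 'I_n, (fun t => w t k) @ \oo --> walpha k),
        (exists K q : R, 0 < q < 1 /\
           forall t : nat, bnorm p (w t - walpha) <= K * q ^+ t) &
        (forall t : nat,
           bnorm p (w t.+1 - walpha) <=
             V * (1 - C * alpha) ^+ t.+1 * bnorm p (w0 - walpha)
             + remainder alpha b rho C Rad t)].
Proof.
move=> d_gt0 _ [Wpos W0 W_col] [Wp p1 p_gt0] rho rho01 a_gt0 rate cases b Rad alpha.
move=> /andP[alpha_gt0 alpha_le] V w.
have n_gt0 : (0 < n)%N.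
  rewrite lt0n; apply/eqP => n0; subst n; move: p1.
  by rewrite big_ord0 => /eqP; rewrite eq_sym oner_eq0.
have W_ge0 i j : 0 <= W i j.
  by case: (boolP (E i j || (i == j))) => [/Wpos/ltW//|/W0->].
have step : contractive_step W p f alpha C (max_of L).
  by case: cases => [/case1_contractive_step|/case2_contractive_step]; apply.
exact (gradient_push_convergence w0 p_gt0 W_ge0 W_col Wp rho01 a_gt0 rate
  alpha_gt0 step).
Qed.
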